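(* The logarithmic mean $\mathcal{L}\colon\mathbb{R}_+^2\to\mathbb{R}_+$, given by $$\mathcal{L}(x,y)=\frac{x-y}{\log x-\log y}\quad (x\ne y),\qquad \mathcal{L}(x,x)=x,$$ is not of power growth but is of generalized power growth, and $\operatorname{ord}^*(\mathcal{L})=0$.
   Context: $\mathbb{R}_+:=(0,\infty)$. A (bivariate) mean is an arbitrary function $M\colon\mathbb{R}_+\times\mathbb{R}_+\to\mathbb{R}_+$ with $\min(x,y)\le M(x,y)\le\max(x,y)$ for all $x,y\in\mathbb{R}_+$. It is symmetric if $M(x,y)=M(y,x)$ for all $x,y\in\mathbb{R}_+$, and homogeneous if $M(tx,ty)=tM(x,y)$ for all $x,y,t\in\mathbb{R}_+$. $\mathcal{HS}$ denotes the family of all homogeneous, symmetric means $M\colon\mathbb{R}_+^2\to\mathbb{R}_+$; the logarithmic mean belongs to $\mathcal{HS}$. A mean $M\in\mathcal{HS}$ is of power growth if there exist a real number $\operatorname{ord}(M)$ and a number $C_M\in(0,\infty)$ such that $\lim_{x\to0^+}\frac{M(x,1)}{x^{\operatorname{ord}(M)}}=C_M$. For $M\in\mathcal{HS}$ the lower order and upper order are the real numbers $$\operatorname{lord}(M):=\sup\Big\{\alpha\in\mathbb{R}\colon \limsup_{x\to0^+}\frac{M(x,1)}{x^\alpha}=0\Big\},\qquad \operatorname{uord}(M):=\inf\Big\{\alpha\in\mathbb{R}\colon \liminf_{x\to0^+}\frac{M(x,1)}{x^\alpha}=\infty\Big\}.$$ A mean $M\in\mathcal{HS}$ is of generalized power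 growth if $\operatorname{lord}(M)=\operatorname{uord}(M)$, and in this case $\operatorname{ord}^*(M):=\operatorname{lord}(M)=\operatorname{uord}(M)$. *)

(* Defs.v *)
From HB Require Import structures.
From mathcomp Require Import all_boot all_order all_algebra.
From mathcomp Require Import all_classical all_reals all_analysis.
From mathcomp Require Import ring lra.
Set Implicit Arguments.
Unset Strict Implicit.
Unset Printing Implicit Defensive.
Import Order.TTheory GRing.Theory Num.Theory.
Import numFieldNormedType.Exports.
Local Open Scope classical_set_scope.
Local Open Scope ring_scope.

(* A function on (0, oo)^2 is represented by a total function R -> R -> R; only
   its values at positive arguments are constrained or used below.  Positivity
   of these values follows from the lower bound [Num.min x y]. *)
Definition is_mean (R : realType) (M : R -> R -> R) : Prop :=
  forall x y : R, 0 < x -> 0 < y -> Num.min x y <= M x y <= Num.max x y.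

Definition symmetric_mean (R : realType) (M : R -> R -> R) : Prop :=
  forall x y : R, 0 < x -> 0 < y -> M x y = M y x.

Definition homogeneous_mean (R : realType) (M : R -> R -> R) : Prop :=
  forall x y t : R, 0 < x -> 0 < y -> 0 < t -> M (t * x) (t * y) = t * M x y.

Record HS (R : realType) := MkHS {
  HS_fun :> R -> R -> R;
  HS_is_mean : is_mean HS_fun;
  HS_symmetric : symmetric_mean HS_fun;
  HS_homogeneous : homogeneous_mean HS_fun }.

Definition power_growth (R : realType) (M : HS R) : Prop :=
  exists ord C : R, 0 < C /\ M x 1 / (x `^ ord) @[x --> 0^'+] --> C.

(* The supremum and infimum of a set of reals are taken in the extended reals,
   so that no default value is involved: [sup] and [inf] on R are 0 on empty or
   unbounded sets.  For M in HS both orders are finite, since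
   x <= M x 1 <= 1 for 0 < x <= 1. *)
Definition lord (R : realType) (M : HS R) : \bar R :=
  ereal_sup [set alpha%:E | alpha in [set alpha : R |
    limf_esup (fun x : R => (M x 1 / (x `^ alpha))%:E) 0^'+ = 0%E]].

Definition uord (R : realType) (M : HS R) : \bar R :=
  ereal_inf [set alpha%:E | alpha in [set alpha : R |
    limf_einf (fun x : R => (M x 1 / (x `^ alpha))%:E) 0^'+ = +oo%E]].

Definition generalized_power_growth (R : realType) (M : HS R) : Prop :=
  lord M = uord M.

(* Meaningful when [generalized_power_growth M] holds. *)
Definition ord_star (R : realType) (M : HS R) : \bar R := lord M.

Definition log_mean_fun (R : realType) (x y : R) : R :=
  if x == y then x else (x - y) / (ln x - ln y).

Lemma log_mean_fun_symmetric (R : realType) : symmetric_mean (@log_mean_fun R).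
Proof.
move=> x y _ _; rewrite /log_mean_fun eq_sym; case: eqVneq => // _.
by rewrite -(opprB y x) -(opprB (ln y)) invrN mulrNN.
Qed.

Lemma log_mean_fun_homogeneous (R : realType) :
  homogeneous_mean (@log_mean_fun R).
Proof.
move=> x y t x0 y0 t0; rewrite /log_mean_fun (inj_eq (mulfI (lt0r_neq0 t0))).
case: eqVneq => // _.
by rewrite !lnM ?posrE// -mulrBr -mulrA; congr (_ * (_ / _)); ring.
Qed.

Lemma log_mean_fun_bounds (R : realType) (x y : R) :
  0 < x -> x < y -> x <= log_mean_fun x y <= y.
Proof.
move=> x0 xy; have y0 := lt_trans x0 xy.
rewrite /log_mean_fun lt_eqF// -(opprB y x) -(opprB (ln y)) invrN mulrNN.
have l0 : 0 < ln y - ln x by rewrite subr_gt0 ltr_ln.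
have ln_le (a b : R) : 0 < a -> 0 < b -> ln a - ln b <= (a - b) / b.
  move=> a0 b0; rewrite -ln_div ?posrE// mulrBl divff ?gt_eqF//.
  rewrite -{1}(subrK 1 (a / b)) addrC; apply: le_ln1Dx.
  by rewrite ltrBrDr addNr divr_gt0.
rewrite ler_pdivlMr// ler_pdivrMr//; apply/andP; split.
  by rewrite mulrC -ler_pdivlMr// ln_le.
have := ln_le x y x0 y0; rewrite ler_pdivlMr// => h; lra.
Qed.

Lemma log_mean_fun_is_mean (R : realType) : is_mean (@log_mean_fun R).
Proof.
move=> x y x0 y0; case: (ltgtP x y) => [xy|yx|<-].
- exact: log_mean_fun_bounds.
- by rewrite log_mean_fun_symmetric//; exact: log_mean_fun_bounds.
- by rewrite /log_mean_fun eqxx lexx.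
Qed.

Definition log_mean (R : realType) : HS R :=
  MkHS (@log_mean_fun_is_mean R) (@log_mean_fun_symmetric R)
       (@log_mean_fun_homogeneous R).

(* Main.v *)
(* As x -> 0+, L(x, 1) = (1 - x) / (- ln x), so L(x, 1) / x^a behaves like
   x^(-a) / (- ln x): it tends to 0 for a <= 0 and to +oo for a > 0.  Hence no
   exponent gives a limit in (0, oo), and 0 separates the two regimes. *)
Require Import Defs.
From mathcomp Require Import all_boot all_order all_algebra.
From mathcomp Require Import all_classical all_reals all_analysis.
From mathcomp Require Import ring lra.
Import Order.TTheory GRing.Theory Num.Theory.
Import numFieldNormedType.Exports.
Local Open Scope classical_set_scope.
Local Open Scope ring_scope.

(** For every [z] above [l], the set where [f < z] is in [F] and bounds the limsup by [z].
    Conversely, if some [V] in [F] had a supremum below [l], then [f] would exceed that supremum on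
    a member of [F]; properness makes this member meet [V], which is absurd. The limit may be
    infinite, so both regimes of the quotient are covered. *)
Lemma cvg_limf_esup (R : realType) (T : choiceType) (X : filteredType T)
    (F : set_system X) (f : X -> \bar R) (l : \bar R) :
  ProperFilter F -> f @ F --> l -> limf_esup f F = l.
Proof.
move=> FF fl; have near_l (A : set (\bar R)) : open A -> A l -> F (f @^-1` A).
  by move=> oA Al; apply: (fl A); exact: open_nbhs_nbhs.
rewrite limf_esupE; apply/eqP; rewrite eq_le; apply/andP; split.
- have ub (z : \bar R) : (l < z)%E ->
      (ereal_inf [set ereal_sup (f @` V) | V in F] <= z)%E.
    move=> lz; apply: ge_ereal_inf; exists (ereal_sup (f @` [set x | (f x < z)%E])).
      exists [set x | (f x < z)%E] => //.
      exact: (near_l [set y | (y < z)%E] (@open_ereal_lt_ereal _ z) lz).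
    by apply: ge_ereal_sup => _ [x /= /ltW fxz <-].
  (* Letting [z] decrease to [l]: through [l + e] when [l] is finite, through all reals when [l] is
     [-oo]; for [+oo] there is nothing to bound. *)
  case: l {fl near_l} ub => [r| |] ub; last 2 first.
  + exact: leey.
  + by rewrite (eq_ninfty (fun A => ub _ (ltNyr A))).
  + by apply/lee_addgt0Pr => e e0; apply: ub; rewrite lte_fin ltrDl.
- apply: le_ereal_inf_tmp => _ [V FV <-]; rewrite leNgt; apply/negP => Vl.
  have /(filterI FV)/filter_ex[x [Vx]] /= :
      F [set x | (ereal_sup (f @` V) < f x)%E].
    exact: (near_l [set y | (_ < y)%E] (@open_ereal_gt_ereal _ _) Vl).
  by apply/negP; rewrite -leNgt; apply: ereal_sup_ubound; exists x.
Qed.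

Lemma cvg_limf_einf (R : realType) (T : choiceType) (X : filteredType T)
    (F : set_system X) (f : X -> \bar R) (l : \bar R) :
  ProperFilter F -> f @ F --> l -> limf_einf f F = l.
Proof.
move=> FF /cvgeN fl.
by rewrite /limf_einf (cvg_limf_esup _ _ _ _ _ _ FF fl) oppeK.
Qed.

Lemma cvg_ln_neg_pinfty (R : realType) : (- ln x : R) @[x --> 0^'+] --> +oo.
Proof. by apply/cvgNry; exact: lnNy. Qed.

(** In the variable [t = - ln x], which tends to [+oo], the quotient is
    [(1 - x) / t * expR (a * t)], so the sign of [a] decides the limit. *)
Lemma log_mean_div_powRE (R : realType) (a x : R) : 0 < x -> x < 1 ->
  log_mean R x 1 / x `^ a = (1 - x) / (- ln x) * expR (a * - ln x).
Proof.
move=> x0 x1; rewrite /= /log_mean_fun lt_eqF// ln1 subr0.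
rewrite /powR gt_eqF// -expRN mulrN; congr (_ * _).
by rewrite -(opprB 1 x) mulNr invrN mulrN.
Qed.

Lemma log_mean_div_powR_cvg0 (R : realType) (a : R) : a <= 0 ->
  log_mean R x 1 / x `^ a @[x --> 0^'+] --> 0.
Proof.
(* For [a <= 0] both [1 - x] and the exponential are at most 1, which leaves [1 / t] as a
   majorant. *)
move=> a0; apply: (@squeeze_cvgr _ _ _ _ (cst 0) (fun x => (- ln x)^-1)).
- near=> x.
  have x0 : 0 < x by near: x; exact: nbhs_right_gt.
  have x1 : x < 1 by near: x; exact: nbhs_right_lt.
  have t0 : 0 < - ln x by rewrite oppr_gt0 ln_lt0// x0.
  rewrite log_mean_div_powRE// /cst; apply/andP; split.
    by rewrite mulr_ge0 ?expR_ge0// divr_ge0// ?subr_ge0 ltW.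
  rewrite mulrAC -[leRHS]mul1r ler_wpM2r ?invr_ge0 ?(ltW t0)//.
  have : expR (a * - ln x) <= 1 by rewrite -expR0 ler_expR mulr_le0_ge0// ltW.
  have := expR_gt0 (a * - ln x); nra.
- exact: cvg_cst.
- apply/gtr0_cvgV0; last exact: cvg_ln_neg_pinfty.
  near=> x; rewrite oppr_gt0 ln_lt0//; apply/andP; split.
    by near: x; exact: nbhs_right_gt.
  by near: x; exact: nbhs_right_lt.
Unshelve. all: by end_near. Qed.

Lemma log_mean_div_powR_cvgy (R : realType) (a : R) : 0 < a ->
  log_mean R x 1 / x `^ a @[x --> 0^'+] --> +oo.
Proof.
(* The minorant is [t * (a ^+ 2 / 4)]: one factor 1/2 comes from [1 - x >= 1/2], the other from the
   coefficient of [(a * t) ^+ 2] in the exponential series. *)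
move=> a0; apply: (@ger_cvgy _ _ _ _ (fun x => - ln x * (a ^+ 2 / 4))).
- near=> x.
  have x0 : 0 < x by near: x; exact: nbhs_right_gt.
  have x2 : x < 2^-1 by near: x; apply: nbhs_right_lt; rewrite invr_gt0.
  have x1 : x < 1 by lra.
  have t0 : 0 < - ln x by rewrite oppr_gt0 ln_lt0// x0.
  rewrite log_mean_div_powRE//.
  move: (- ln x) t0 => t t0.
  (* The quadratic term of exp beats the factor 1 / t. *)
  have := expR_ge1Dxn 1 (ltW (mulr_gt0 a0 t0)).
  rewrite (_ : 2`! = 2)%N// => h; rewrite [leRHS]mulrAC ler_pdivlMr//.
  have : expR (a * t) / 2 <= (1 - x) * expR (a * t).
    by rewrite mulrC ler_wpM2r ?expR_ge0//; lra.
  have -> : t * (a ^+ 2 / 4) * t = (a * t) ^+ 2 / 2 / 2 by field.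
  lra.
- by apply: gt0_cvgMly; [rewrite divr_gt0 ?exprn_gt0|exact: cvg_ln_neg_pinfty].
Unshelve. all: by end_near. Qed.

Lemma lord_log_mean (R : realType) : lord (log_mean R) = 0%E.
Proof.
rewrite /lord.
suff -> : [set alpha : R | limf_esup (fun x : R =>
    (log_mean R x 1 / x `^ alpha)%:E) 0^'+ = 0%E] = [set a | a <= 0].
  apply/eqP; rewrite eq_le; apply/andP; split.
    by apply: ge_ereal_sup => _ [a /= a0 <-]; rewrite lee_fin.
  by apply: ereal_sup_ubound; exists 0 => /=.
apply/seteqP; split => a /=; last first.
  by move=> a0; apply: cvg_limf_esup; apply: cvg_EFin;
    [exact: nearW|exact: log_mean_div_powR_cvg0].
(* For [a > 0] the limsup is [+oo], so it cannot be 0. *)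
case: (leP a 0) => // /log_mean_div_powR_cvgy/cvgeryP.
by move=> /cvg_limf_esup ->.
Qed.

Lemma uord_log_mean (R : realType) : uord (log_mean R) = 0%E.
Proof.
rewrite /uord.
suff -> : [set alpha : R | limf_einf (fun x : R =>
    (log_mean R x 1 / x `^ alpha)%:E) 0^'+ = +oo%E] = [set a | 0 < a].
  apply/eqP; rewrite eq_le; apply/andP; split.
    (* The exponent 0 itself is excluded, since its quotient tends to 0; the infimum is only
       approached, through the positive exponents [e]. *)
    apply/lee_addgt0Pr => e e0; rewrite add0e.
    by apply: ereal_inf_lbound; exists e.
  by apply: le_ereal_inf_tmp => _ [a /= a0 <-]; rewrite lee_fin ltW.
apply/seteqP; split => a /=; last first.
  by move=> /log_mean_div_powR_cvgy/cvgeryP/cvg_limf_einf.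
case: (ltP 0 a) => // /log_mean_div_powR_cvg0 h.
by rewrite (_ : limf_einf _ _ = 0%E)//; apply: cvg_limf_einf; apply: cvg_EFin;
  [exact: nearW|].
Qed.

Lemma log_mean_not_power_growth (R : realType) : ~ power_growth (log_mean R).
Proof.
move=> [a [C [C0 hC]]]; have [a0|a0] := leP a 0.
  have CE : C = 0.
    exact: (cvg_unique (@Rhausdorff R) hC (log_mean_div_powR_cvg0 _ _ a0)).
  by rewrite CE ltxx in C0.
(* For [a > 0], any point close enough to 0 has a quotient both at least [C + 1], by divergence, and
   below [C + 1], by convergence to [C]. *)
have /cvgryPge/(_ (C + 1)) large := log_mean_div_powR_cvgy _ _ a0.
near (0 : R)^'+ => x.
suff : C + 1 < C + 1 by rewrite ltxx.
apply: (@le_lt_trans _ _ (log_mean R x 1 / x `^ a)).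
  by near: x; exact: large.
by near: x; apply: (cvgr_lt _ hC); rewrite ltrDl.
Unshelve. all: by end_near. Qed.

Theorem proposition4p3 (R : realType) :
  ~ power_growth (log_mean R) /\
  generalized_power_growth (log_mean R) /\
  ord_star (log_mean R) = 0%E.
Proof.
split; first exact: log_mean_not_power_growth.
by rewrite /generalized_power_growth /ord_star lord_log_mean uord_log_mean.
Qed.
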